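(* Let $V$ be a real reflexive Banach space with norm $\|\cdot\|$, dual $V^*$ and duality brackets $\langle\cdot,\cdot\rangle$, and let $X$ be a real Hilbert space with norm $\|\cdot\|_X$. Let $A\colon V\to V^*$, $j\colon X\times X\to\mathbb{R}$, $M\colon V\to X$, $U\colon V\to 2^V$, $\phi\colon V\to\mathbb{R}$ and $f\in V^*$ satisfy the following. (A) $A$ is pseudomonotone, and there is $m_A>0$ with $\langle Av_1-Av_2,v_1-v_2\rangle\ge m_A\|v_1-v_2\|^2$ for all $v_1,v_2\in V$. (j) (i) $j(w,\cdot)$ is locally Lipschitz for all $w\in X$; (ii) there are $d_1,d_2,d_3\ge 0$ such that $\|\partial j(w,v)\|_X\le d_1+d_2\|w\|_X+d_3\|v\|_X$ for all $w,v\in X$; (iii) the map $X\times X\times X\ni(w,v,z)\mapsto j^0(w,v;z)\in\mathbb{R}$ is upper semicontinuous. (M) $M$ is linear, bounded and compact. (U) $U$ has nonempty, closed, convex values, $0\in U(v)$ for all $v\in V$, and $U$ is weakly Mosco continuous: if $v_n\rightharpoonup v$ weakly in $V$, then $U(v_n)$ converges to $U(v)$ in the Mosco sense. ($\phi$) $\phi$ is convex and lower semicontinuous on $V$, and there is $c_\phi>0$ such that $\phi(v_1)-\phi(v_2)\le c_\phi\|v_1-v_2\|$ for all $v_1,v_2\in V$. Assume moreover that $(d_2+d_3)\|M\|^2<m_A$. Then the set of all $u\in V$ such that $u\in U(u)$ and $$\langle Au-f,z-u\rangle+j^0(Mu,Mu;Mz-Mu)+\phi(z)-\phi(u)\ge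 0\quad\text{for all } z\in U(u)$$ is compact in $V$ (in the norm topology).
   Context: For a locally Lipschitz function $h\colon X\to\mathbb{R}$, the Clarke generalized directional derivative is $h^0(x;v)=\limsup_{y\to x,\ \lambda\downarrow 0}\frac{h(y+\lambda v)-h(y)}{\lambda}$ and the generalized subgradient is $\partial h(x)=\{\zeta\in X^*\mid h^0(x;v)\ge\langle\zeta,v\rangle\ \text{for all } v\in X\}$; here $X^*$ is identified with the Hilbert space $X$. For $j\colon X\times X\to\mathbb{R}$, $j^0(w,v;z)$ and $\partial j(w,v)$ denote the generalized directional derivative (in direction $z$) and the generalized subgradient of $j(w,\cdot)$ at $v$, with $w$ fixed. For a set $S$, $\|S\|_X=\sup\{\|x\|_X\mid x\in S\}$. $\|M\|$ is the operator norm. An operator $A\colon V\to V^*$ is pseudomonotone if it maps bounded sets into bounded sets and, whenever $u_n\rightharpoonup u$ in $V$ with $\limsup\langle Au_n,u_n-u\rangle\le 0$, one has $\langle Au,u-v\rangle\le\liminf\langle Au_n,u_n-v\rangle$ for all $v\in V$. A sequence $\{C_n\}$ of closed convex subsets of a normed space $Y$ converges in the Mosco sense to a closed convex set $C\subset Y$ if: $(m_1)$ whenever $z_n\in C_n$ and $z_n\rightharpoonup z$ weakly in $Y$ along a subsequence, then $z\in C$; $(m_2)$ for every $z\in C$ there exist $z_n\in C_n$ with $z_n\to z$ strongly in $Y$. *)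

(* Defs.v *)
From HB Require Import structures.
From mathcomp Require Import all_boot all_order all_algebra.
From mathcomp Require Import all_classical all_reals all_analysis.
From mathcomp Require Import ring.

Set Implicit Arguments.
Unset Strict Implicit.
Unset Printing Implicit Defensive.

Import Order.TTheory GRing.Theory Num.Theory.
Import numFieldNormedType.Exports.

Local Open Scope classical_set_scope.
Local Open Scope ring_scope.

(* Meaningful for bounded linear [f] only: [sup] of an unbounded set is 0. *)
Definition opnorm (R : realType) (E F : normedModType R) (f : E -> F) : R :=
  sup [set `|f x| | x in [set x | `|x| <= 1]].

Definition dual_pred (R : realType) (E : normedModType R) : {pred E -> R^o} :=
  fun f => `[< linear f /\ continuous f >].

(* The topological dual [E^*], a normed module for [opnorm]; the duality
   bracket <f, x> is the application [f x]. *)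
Record dual (R : realType) (E : normedModType R) := Dual {
  dual_fun :> E -> R^o;
  dualP : dual_fun \in @dual_pred R E }.

Section dual_space.
Context (R : realType) (E : normedModType R).
Implicit Types f g : dual E.

HB.instance Definition _ := [isSub for @dual_fun R E].
HB.instance Definition _ := [Choice of dual E by <:].

Lemma dual_submod_closed : submod_closed (@dual_pred R E).
Proof.
split.
  apply/asboolT; split; last exact: cst_continuous.
  by move=> a x y; rewrite /= scaler0 addr0.
move=> a f g /asboolP[fl fc] /asboolP[gl gc].
apply/asboolT; split.
  move=> b x y; rewrite !fctE fl gl /GRing.scale/=; ring.
move=> x; apply: cvgD; last exact: gc.
by apply: cvgZr; exact: fc.
Qed.

HB.instance Definition _ :=
  GRing.isSubmodClosed.Build R (E -> R^o) (@dual_pred R E) dual_submod_closed.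
HB.instance Definition _ := [SubChoice_isSubLmodule of dual E by <:].

Lemma dual_linear f : linear f.
Proof. by case/asboolP: (dualP f). Qed.

HB.instance Definition _ f :=
  GRing.isLinear.Build R E R^o _ (dual_fun f) (@dual_linear f).

Lemma dual_continuous f : continuous f.
Proof. by case/asboolP: (dualP f). Qed.


Lemma dual_opnorm_ub f x : `|x| <= 1 -> `|f x| <= opnorm f.
Proof.
move=> x1; apply: ub_le_sup; last by exists x.
have /linear_boundedP/pinfty_ex_gt0[r r0 fr] :=
  @continuous_linear_bounded _ _ _ 0 f (@dual_continuous f 0).
exists r => _ [y /= y1 <-]; apply: (le_trans (fr y)).
by rewrite ler_piMr // ltW.
Qed.

Lemma dual_opnorm_le f r :
  (forall x, `|x| <= 1 -> `|f x| <= r) -> opnorm f <= r.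
Proof.
move=> fr; apply: ge_sup; first by exists `|f 0|, 0; rewrite //= normr0.
by move=> _ [x /= x1 <-]; exact: fr.
Qed.

Lemma dual_opnormD f g : opnorm (f + g) <= opnorm f + opnorm g.
Proof.
apply: dual_opnorm_le => x x1; rewrite (le_trans (ler_normD _ _))//.
by rewrite lerD// dual_opnorm_ub.
Qed.

Let dual_opnormZ_le a f : opnorm (a *: f) <= `|a| * opnorm f.
Proof.
by apply: dual_opnorm_le => x x1; rewrite normrM ler_wpM2l// dual_opnorm_ub.
Qed.

Lemma dual_opnormZ a f : opnorm (a *: f) = `|a| * opnorm f.
Proof.
apply/eqP; rewrite eq_le dual_opnormZ_le /=.
have [->|a0] := eqVneq a 0.
  rewrite normr0 mul0r (le_trans (normr_ge0 ((0 *: f : dual E) 0)))//.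
  by rewrite dual_opnorm_ub// normr0.
rewrite -ler_pdivlMl ?normr_gt0//.
rewrite -[f in leLHS]scale1r -(mulVf a0) -scalerA -normfV.
exact: dual_opnormZ_le.
Qed.

Lemma dual_opnorm0_eq0 f : opnorm f = 0 -> f = 0.
Proof.
move=> f0; apply/val_inj/funext => x /=.
have [->|x0] := eqVneq x 0; first exact: linear0.
have nx0 : `|x| != 0 by rewrite normr_eq0.
have : `|f (`|x|^-1 *: x)| <= opnorm f.
  by rewrite dual_opnorm_ub// normrZ normfV normr_id mulVf.
rewrite f0 normr_le0 linearZ/= scaler_eq0 invr_eq0 (negbTE nx0)/=.
by move/eqP.
Qed.

HB.instance Definition _ := Lmodule_isNormed.Build R (dual E)
  dual_opnormD dual_opnormZ dual_opnorm0_eq0.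

End dual_space.

(* Surjectivity of the canonical embedding of [E] into [dual (dual E)]. *)
Definition reflexive_space (R : realType) (E : normedModType R) :=
  forall F : dual (dual E), exists x : E, forall f : dual E, F f = f x.

Definition weak_cvg (R : realType) (E : normedModType R) (u : E^nat) (x : E) :=
  forall f : dual E, (fun n => f (u n)) @ \oo --> f x.

(* To be used for sequences and limits that are closed and convex. *)
Definition mosco_cvg (R : realType) (E : normedModType R)
    (C_ : nat -> set E) (C : set E) :=
  (forall (z : E^nat) (k : nat -> nat) (z0 : E), (forall n, C_ n (z n)) ->
     increasing_seq k -> weak_cvg (z \o k) z0 -> C z0) /\
  (forall z0, C z0 ->
     exists2 z : E^nat, (forall n, C_ n (z n)) & z @ \oo --> z0).

Definition weakly_mosco_continuous (R : realType) (E : normedModType R)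
    (U : E -> set E) :=
  forall (v : E^nat) (v0 : E), weak_cvg v v0 -> mosco_cvg (U \o v) (U v0).

Definition pseudomonotone (R : realType) (E : normedModType R)
    (A : E -> dual E) :=
  (forall B : set E, bounded_set B -> bounded_set (A @` B)) /\
  (forall (u : E^nat) (u0 : E), weak_cvg u u0 ->
     (limn_esup (fun n => (A (u n) (u n - u0))%:E) <= 0)%E ->
     forall v, ((A u0 (u0 - v))%:E <=
                limn_einf (fun n => (A (u n) (u n - v))%:E))%E).

Definition compact_operator (R : realType) (E F : normedModType R)
    (f : E -> F) :=
  forall B : set E, bounded_set B -> precompact (f @` B).

Definition upper_semicontinuous (R : realType) (T : topologicalType)
    (f : T -> \bar R) := lower_semicontinuous (\- f)%E.

Definition locally_lipschitz (R : realType) (E : normedModType R)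
    (h : E -> R) :=
  forall x : E, exists2 W, nbhs x W & [lipschitz (h y : R^o) | y in W].

(* limsup of the difference quotients as y -> x, lambda -> 0+; it is finite
   when [h] is locally Lipschitz. *)
Definition clarke (R : realType) (E : normedModType R) (h : E -> R)
    (x v : E) : \bar R :=
  limf_esup (fun p : E * R => ((h (p.1 + p.2 *: v) - h p.1) / p.2)%:E)
    (filter_prod (nbhs x) 0^'+).

(* Subgradients are elements of the Hilbert space [X] itself, through the Riesz
   identification of [zeta] with [ip zeta]. *)
Definition clarke_subgrad (R : realType) (X : normedModType R)
    (ip : X -> X -> R) (h : X -> R) (x : X) : set X :=
  [set zeta | forall v, ((ip zeta v)%:E <= clarke h x v)%E].

(* Valued in [\bar R]; the norm of the empty set is -oo. *)
Definition set_norm (R : realType) (X : normedModType R) (S : set X) : \bar R :=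
  ereal_sup [set `|x|%:E | x in S].

Definition solution_set (R : realType) (V X : normedModType R)
    (A : V -> dual V) (f : dual V) (j : X -> X -> R) (M : V -> X)
    (phi : V -> R) (U : V -> set V) : set V :=
  [set u | U u u /\ forall z, U u z ->
    (0 <= ((A u - f) (z - u))%:E + clarke (j (M u)) (M u) (M z - M u)%R
          + (phi z - phi u)%:E)%E].

(* Main.v *)
Require Import Defs.
From HB Require Import structures.
From mathcomp Require Import all_boot all_order all_algebra.
From mathcomp Require Import all_classical all_reals all_analysis.
From mathcomp Require Import ring lra.

Set Implicit Arguments.
Unset Strict Implicit.
Unset Printing Implicit Defensive.

Import Order.TTheory GRing.Theory Num.Theory.
Import numFieldNormedType.Exports.

Local Open Scope classical_set_scope.
Local Open Scope ring_scope.

(* Testing the inequality with [z = 0], the smallness condition bounds the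
   solutions. By reflexivity a sequence of solutions has a weakly convergent
   subsequence [u_n] with limit [u], and [M u_n] tends to [M u] in norm. Mosco
   convergence yields [u \in U u] and [y_n \in U u_n] tending to [u]; testing
   with [y_n] gives [limsup <A u_n, u_n - u> <= 0], which strong monotonicity
   turns into norm convergence of [u_n]. Pseudomonotonicity of [A] and upper
   semicontinuity of [j^0] then pass the inequality to the limit.

   Weak sequential compactness is obtained without separability of the dual: an
   ultrafilter limit of [u_n] in the bidual is a point [x], a diagonal
   subsequence converges to [x] against countably many functionals norming the
   rational span of the [u_n], and these functionals separate the possible
   ultrafilter limits of that subsequence. *)

(** * Subgradients and bounded functionals *)

Definition convex_real (R : realType) (E : lmodType R) (p : E -> R) :=
  forall (x y : E) (s t : R), 0 <= s -> 0 <= t -> s + t = 1 ->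
    p (s *: x + t *: y) <= s * p x + t * p y.

(** Convexity homogenised to positive weights of arbitrary sum, as needed for the one-step extension
    in Hahn-Banach. *)
Lemma convex_combination (R : realType) (E : lmodType R) (p : E -> R)
    (x y : E) (s t : R) : convex_real p -> 0 < s -> 0 < t ->
  (s + t) * p ((s + t)^-1 *: (s *: x + t *: y)) <= s * p x + t * p y.
Proof.
move=> cp s0 t0; have st0 : 0 < s + t by rewrite addr_gt0.
rewrite -ler_pdivlMl// scalerDr !scalerA.
apply: le_trans (cp _ _ _ _ _ _ _) _.
- by rewrite mulr_ge0 ?invr_ge0 ?ltW.
- by rewrite mulr_ge0 ?invr_ge0 ?ltW.
- by rewrite -mulrDr mulVf// gt_eqF.
- by rewrite mulrDr !mulrA.
Qed.

(* Partial linear functionals below [p] are encoded by their graphs; the graph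
   is automatically functional because a line is not below [p 0]. *)
Lemma hahn_banach_convex (R : realType) (E : lmodType R) (p : E -> R) :
  convex_real p -> 0 <= p 0 ->
  exists g : E -> R^o, linear g /\ forall v, g v <= p v.
Proof.
move=> cp p0.
pose P (G : set (E * R)) := (forall a z w, G z -> G w ->
   G (a *: z.1 + w.1, a * z.2 + w.2)) /\ forall z, G z -> z.2 <= p z.1.
have [F FP tF|G [[Glin Gp] Gmax]] := @Zorn_bigcup (E * R)%type P.
  split=> [a z w [A FA Az] [B FB Bw]|z [A FA Az]]; last exact: (FP _ FA).2.
  have [AB|BA] := tF _ _ FA FB.
    by exists B => //; apply: (FP _ FB).1 => //; exact: AB.
  by exists A => //; apply: (FP _ FA).1 => //; exact: BA.
(* [P] holds for the empty graph, so a maximal [G] might be empty; but then the graph [{(0, 0)}],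
   which lies below [p] because [0 <= p 0], would be larger. *)
have G0 : G (0, 0).
  have [[z Gz]|GN0] := pselect (exists z, G z).
    have := Glin (-1) _ _ Gz Gz.
    by rewrite scaleN1r mulN1r !addNr.
  have G00 : ~ P [set (0, 0)].
    apply: Gmax; split=> [z Gz|/(_ (0, 0))/(_ erefl) G0].
      by exfalso; apply: GN0; exists z.
    by apply: GN0; exists (0, 0).
  exfalso; apply: G00; split=> [a z w /= -> -> /=|z /= -> //].
  by rewrite scaler0 mulr0 !addr0.
have GZ a z : G z -> G (a *: z.1, a * z.2).
  by move=> Gz; have := Glin a _ _ Gz G0; rewrite /= !addr0.
have GD z w : G z -> G w -> G (z.1 + w.1, z.2 + w.2).
  by move=> Gz Gw; have := Glin 1 _ _ Gz Gw; rewrite scale1r mul1r.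
have Gfun v r s : G (v, r) -> G (v, s) -> r = s.
  move=> Gr Gs; apply/eqP; rewrite -subr_eq0; apply: contraT => rs.
  have Gd : G (0, r - s).
    by have := Glin (-1) _ _ Gs Gr; rewrite /= scaleN1r mulN1r addNr addrC.
  (* This multiple of [(0, r - s)] is [(0, p 0 + 1)]. *)
  have := Gp _ (GZ ((p 0 + 1) / (r - s)) _ Gd).
  by rewrite /= scaler0 divfK// gerDl ler10.
have Gdom v : exists r, G (v, r).
  apply: contrapT => vG.
  (* [S] collects the lower bounds that the points [z - s v] impose on the value at [v]. By [Sub]
     they stay below all upper bounds imposed by points [z + t v], so [sup S] is an admissible
     value. *)
  pose S := [set r | exists z s, [/\ G z, 0 < s &
      r = (z.2 - p (z.1 - s *: v)) / s]].
  have Sub z t : G z -> 0 < t -> ubound S ((p (z.1 + t *: v) - z.2) / t).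
    move=> Gz t0 _ [w [s [Gw s0 ->]]].
    rewrite ler_pdivrMr// mulrAC ler_pdivlMr//.
    have st0 : s + t != 0 by rewrite gt_eqF// addr_gt0.
    have := Gp _ (GZ (s + t)^-1 _ (GD _ _ (GZ s _ Gz) (GZ t _ Gw))).
    rewrite /= -(@ler_pM2l _ (s + t)) ?addr_gt0// mulrA mulfV// mul1r.
    have -> : s *: z.1 + t *: w.1 =
        s *: (z.1 + t *: v) + t *: (w.1 - s *: v).
      rewrite !scalerDr scalerN !scalerA mulrC [t * s]mulrC.
      by rewrite addrACA subrr addr0.
    move=> /le_trans/(_ (convex_combination _ _ cp s0 t0)).
    lra.
  have S0 : S !=set0 by exists ((0 - p (0 - 1 *: v)) / 1), (0, 0), 1.
  have hS : has_sup S.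
    by split => //; exists ((p (0 + 1 *: v) - 0) / 1); exact: (Sub (0, 0) 1).
  pose a := sup S.
  pose B := [set w | exists z t, [/\ G z, w.1 = z.1 + t *: v &
     w.2 = z.2 + t * a]].
  apply: (Gmax B).
    split=> [z Gz|/(_ (v, a)) BG].
      by exists z, 0; rewrite scale0r mul0r !addr0.
    apply: vG; exists a; apply: BG; exists (0, 0), 1.
    by rewrite /= scale1r mul1r !add0r.
  split=> [b _ _ [z [t [Gz -> ->]]] [w [s [Gw -> ->]]]|_ [z [t [Gz -> ->]]]].
    exists (b *: z.1 + w.1, b * z.2 + w.2), (b * t + s); split => /=.
    - exact: Glin.
    - by rewrite scalerDr scalerDl scalerA addrACA.
    - by rewrite mulrDr mulrDl mulrA addrACA.
  (* For [t > 0] the bound comes from [Sub]; for [t < 0] it comes from the element of [S] with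
     [s = - t]. *)
  have [t0|t0|<-] := ltgtP 0 t; last by rewrite scale0r mul0r !addr0; exact: Gp.
    have : a <= (p (z.1 + t *: v) - z.2) / t by apply: ge_sup => //; exact: Sub.
    rewrite ler_pdivlMr//; lra.
  have : (z.2 - p (z.1 - (- t) *: v)) / (- t) <= a.
    by apply: ub_le_sup; [exact: hS.2|exists z, (- t); rewrite oppr_gt0].
  rewrite scaleNr opprK ler_pdivrMr ?oppr_gt0//; lra.
pose g v : R^o := xget 0 [set r | G (v, r)].
have gG v : G (v, g v).
  by rewrite /g; case: xgetP => // gv; have [r /gv] := Gdom v.
exists g; split=> [a x y|v]; last exact: (Gp _ (gG v)).
by apply: Gfun (gG _) _; have := Glin a _ _ (gG x) (gG y).
Qed.

(** Hahn-Banach for the translate [p (x + v) - p x], which vanishes at [v = 0]. *)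
Lemma convex_subgradient (R : realType) (E : lmodType R) (p : E -> R) (x : E) :
  convex_real p ->
  exists g : E -> R^o, linear g /\ forall v, p x + g (v - x) <= p v.
Proof.
move=> cp; have [||g [gl gp]] := @hahn_banach_convex _ _ (fun v => p (x + v) - p x).
- move=> u v s t s0 t0 st1; have -> : x + (s *: u + t *: v) =
      s *: (x + u) + t *: (x + v).
    by rewrite !scalerDr addrACA -scalerDl st1 scale1r.
  have := cp (x + u) (x + v) _ _ s0 t0 st1; have -> : t = 1 - s by lra.
  lra.
- by rewrite addr0 subrr.
- by exists g; split => // v; have := gp (v - x); rewrite [x + _]addrC subrK; lra.
Qed.

Section dual_facts.
Context (R : realType) (E : normedModType R).

Lemma dual_le (f : dual E) x : `|f x| <= opnorm f * `|x|.
Proof.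
have [->|x0] := eqVneq x 0; first by rewrite linear0 !normr0 mulr0.
have nx0 : 0 < `|x| by rewrite normr_gt0.
rewrite -ler_pdivrMr// mulrC -[X in X * _]ger0_norm ?invr_ge0// -normrM.
have -> : `|x|^-1 * f x = f (`|x|^-1 *: x) by rewrite linearZ.
by apply: dual_opnorm_ub; rewrite normrZ normfV normr_id mulVf ?gt_eqF.
Qed.

Lemma dualB (f : dual E) x y : f (x - y) = f x - f y.
Proof. exact: linearB. Qed.

(** A one-sided bound suffices: at [- v] it gives the other side. *)
Lemma dual_of_linear (g : E -> R^o) (c : R) : linear g ->
  (forall v, g v <= c * `|v|) -> exists f : dual E, forall v, f v = g v.
Proof.
move=> gl gc.
pose G : {linear E -> R^o} := HB.pack g (GRing.isLinear.Build R E R^o _ g gl).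
have gb v : `|g v| <= c * `|v|.
  rewrite ler_norml gc andbT lerNl -(linearN G) -(normrN v); exact: gc.
suff gP : g \in @dual_pred R E by exists (Dual gP).
apply/asboolT; split => //.
apply: (@bounded_linear_continuous _ _ _ G).
apply/linear_boundedP; exists c; split; first by rewrite num_real.
by move=> r cr v /=; rewrite (le_trans (gb v))// ler_wpM2r// ltW.
Qed.

(** The functional is a subgradient of the norm at [y]: testing at [v + y] bounds it by the norm,
    and testing at [0] gives [|y| <= f y]. *)
Lemma norming_functional (y : E) :
  exists f : dual E, (forall v, f v <= `|v|) /\ f y = `|y|.
Proof.
have [g [gl gn]] : exists g : E -> R^o, linear g /\
    forall v, `|y| + g (v - y) <= `|v|.
  apply: convex_subgradient => u v s t s0 t0 _.
  by rewrite (le_trans (ler_normD _ _))// !normrZ !ger0_norm.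
pose G : {linear E -> R^o} := HB.pack g (GRing.isLinear.Build R E R^o _ g gl).
have gle v : g v <= `|v|.
  by have := gn (v + y); rewrite addrK; have := ler_normD v y; lra.
have [|f fg] := @dual_of_linear g 1 gl.
  by move=> v; rewrite mul1r; exact: gle.
exists f; split=> [v|]; rewrite fg //.
by apply/eqP; rewrite eq_le gle; have := gn 0; rewrite sub0r (linearN G : forall x, g (- x) = - g x) normr0 subr_le0.
Qed.

End dual_facts.

(** * Weak sequential compactness *)

(** Each choice sees the list of all earlier ones; this serves both for diagonal subsequences and
    for separated sequences. *)
Lemma dependent_sequence (T : Type) (P : seq T -> T -> Prop) :
  (forall s, exists x, P s x) -> exists u : nat -> T, forall n, P (mkseq u n) (u n).
Proof.
move=> /choice[F FP].
pose s := fix s n := if n is m.+1 then rcons (s m) (F (s m)) else [::].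
have sE n : mkseq (fun m => F (s m)) n = s n.
  by elim: n => // n IHn; rewrite mkseqS IHn.
by exists (fun n => F (s n)) => n; rewrite sE.
Qed.

Lemma increasing_seq_geq_id (k : nat -> nat) : increasing_seq k ->
  forall n, (n <= k n)%N.
Proof.
move=> /increasing_seqP kS; elim=> // n IHn; exact: leq_ltn_trans IHn (kS n).
Qed.

Lemma increasing_seq_cvg (k : nat -> nat) : increasing_seq k -> k @ \oo --> \oo.
Proof.
move=> ik A [N _ NA]; exists N => // n /= Nn; apply: NA => /=.
exact: leq_trans Nn (increasing_seq_geq_id ik n).
Qed.

(** A cluster point of an ultrafilter is a limit, since the filter contains each set or its
    complement. *)
Lemma ultra_compact_cvg (I : Type) (T : topologicalType) (G : set_system I)
    (u : I -> T) (K : set T) : UltraFilter G -> compact K ->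
  (forall i, K (u i)) -> exists x : T, u @ G --> x.
Proof.
move=> UG cK Ku; have PG := ultra_proper (F := G).
have uK : G (u @^-1` K) by apply: filterE => i; exact: Ku.
have [x [Kx ux]] := cK (u @ G) _ uK.
exists x => N xN.
have [//|GN] := in_ultra_setVsetC (u @^-1` N) UG.
by have [y [Ny /Ny]] := ux _ _ (GN : (u @ G) (~` N)) xN.
Qed.

(** If convergence fails for some [e], the indices of the bad terms are compatible with [\oo], and
    an ultrafilter containing them contradicts the hypothesis. *)
Lemma ultra_cvg (R : realType) (E : normedModType R) (v : nat -> E) (l : E) :
  (forall G : set_system nat, UltraFilter G -> \oo `<=` G -> v @ G --> l) ->
  v @ \oo --> l.
Proof.
move=> vG; apply/cvgrPdist_lt => e e0; apply: contrapT => ve.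
pose B := [set n | ~ `|l - v n| < e].
have PB : ProperFilter (within B \oo).
  split; last exact: within_filter.
  by rewrite /within/= => BF; apply: ve; apply: filterS BF => n nB; apply: contrapT.
have [G [UG BG]] := ultraFilterLemma PB; have PG := ultra_proper (F := G).
have /cvgrPdist_lt/(_ _ e0) Gv : v @ G --> l.
  by apply: vG => // A Aoo; apply: BG; apply: filterS Aoo => n An _.
have BB : G B by apply: BG; exact: withinT.
by have [n []] := filter_ex (filterI Gv BB).
Qed.

Section weak_compactness.
Context (R : realType) (E : normedModType R).
Implicit Types (u : nat -> E) (f : dual E).

(** The limits of [f (u n)] along [G] form a bounded linear functional of [f], which reflexivity
    represents by a point. *)
Lemma ultra_weak_limit u (c : R) (G : set_system nat) :
  reflexive_space E -> UltraFilter G -> (forall n, `|u n| <= c) ->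
  exists x, forall f, (fun n => f (u n)) @ G --> f x.
Proof.
move=> rE UG uc; have PG := ultra_proper (F := G).
have c0 : 0 <= c := le_trans (normr_ge0 _) (uc 0%N).
have fuc f n : `|f (u n)| <= opnorm f * c.
  rewrite (le_trans (dual_le _ _))// ler_wpM2l//; exact: (normr_ge0 f).
have /choice[L fL] f : exists l : R, (fun n => f (u n)) @ G --> l.
  apply: (@ultra_compact_cvg _ R _ _ `[- (opnorm f * c), opnorm f * c]) => //.
    exact: segment_compact.
  by move=> n; rewrite /= in_itv/= -ler_norml.
have Ll : linear (L : dual E -> R^o).
  move=> a f g; apply: cvg_unique (fL _) _ => //.
  by apply: cvgD; [apply: cvgZr|]; exact: fL.
have [|F FL] := dual_of_linear (c := c) Ll.
  move=> f; rewrite mulrC; apply: (cvgr_to_le (fL f)).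
  by apply: nearW => n; exact: le_trans (ler_norm _) (fuc f n).
have [x xF] := rE F; exists x => f; rewrite -xF FL; exact: fL.
Qed.

(** With coefficients in a list, the rational combinations are indexed by the countable type
    [seq rat]. *)
Fixpoint lincomb u (s : seq R) : E :=
  if s is a :: s' then a *: u 0 + lincomb (fun n => u n.+1) s' else 0.

Lemma lincomb_combination u a b s t :
  exists r, a *: lincomb u s + b *: lincomb u t = lincomb u r.
Proof.
elim: s t u => [t u|x s IHs [|y t] u].
- elim: t u => [|y t IHt] u; first by exists [::]; rewrite !scaler0 addr0.
  have [r /= rE] := IHt (fun n => u n.+1); exists (b * y :: r) => /=.
  by rewrite scalerDr scalerA addrCA rE.
- have [r /= rE] := IHs [::] (fun n => u n.+1); exists (a * x :: r) => /=.
  by rewrite scalerDr scalerA -addrA rE.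
- have [r /= rE] := IHs t (fun n => u n.+1); exists (a * x + b * y :: r) => /=.
  by rewrite !scalerDr !scalerA addrACA rE -scalerDl.
Qed.

Lemma lincomb_nth u n : exists s, u n = lincomb u s.
Proof.
elim: n u => [|n IHn] u; first by exists [:: 1]; rewrite /= scale1r addr0.
have [s us] := IHn (fun n => u n.+1); exists (0 :: s).
by rewrite /= scale0r add0r.
Qed.

Lemma lincomb_rat_dense u s (e : R) : 0 < e ->
  exists q : seq rat, `|lincomb u s - lincomb u (map ratr q)| <= e.
Proof.
elim: s u e => [|a s IHs] u e e0; first by exists [::]; rewrite subrr normr0 ltW.
have [q qe] := IHs (fun n => u n.+1) (e / 2) ltac:(lra).
pose d := e / 2 / (`|u 0%N| + 1).
have u0 : 0 < `|u 0%N| + 1 by rewrite ltr_wpDl.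
have d0 : 0 < d by rewrite !divr_gt0.
have [r] := @rat_in_itvoo _ a (a + d) ltac:(lra).
rewrite in_itv/= => /andP[ar rad]; exists (r :: q) => /=.
rewrite opprD addrACA -scalerBl (le_trans (ler_normD _ _))//.
rewrite [e in leRHS]splitr lerD// normrZ.
have -> : e / 2 = d * (`|u 0%N| + 1) by rewrite divfK// gt_eqF.
by rewrite ler_pM// ?lerDl// ler_norml; apply/andP; split; lra.
Qed.

(** The distance [d] to the span is convex and invariant under translation by the span, so its
    subgradient [g] at [w] kills every [u n]. Hence [g w = 0], and the subgradient inequality at [0]
    gives [d w <= d 0 = 0]. *)
Lemma annihilator_lincomb u (w : E) :
  (forall f, (forall n, f (u n) = 0) -> f w = 0) ->
  forall e : R, 0 < e -> exists s, `|w - lincomb u s| < e.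
Proof.
move=> uw e e0.
pose S v := [set `|v - lincomb u s| | s in [set: seq R]].
have Slb v : has_lbound (S v) by exists 0 => _ [s _ <-].
have S0 v : S v !=set0 by exists `|v - lincomb u [::]|, [::].
have SP v := conj (S0 v) (Slb v).
pose d v := inf (S v).
have dle v s : d v <= `|v - lincomb u s| by apply: ge_inf => //; exists s.
have dlt v r : d v < r -> exists s, `|v - lincomb u s| < r.
  by move=> /(inf_lt (SP v).1)[_ [s _ <-]]; exists s.
have dconv : convex_real d.
  move=> x y a b a0 b0 ab; apply/ler_addgt0Pr => h h0.
  have [s sh] := dlt x (d x + h) ltac:(lra).
  have [t th] := dlt y (d y + h) ltac:(lra).
  have [r rE] := lincomb_combination u a b s t.
  rewrite (le_trans (dle _ r))// -rE opprD addrACA -!scalerBr.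
  rewrite (le_trans (ler_normD _ _))// !normrZ !ger0_norm//.
  have := ler_wpM2l a0 (ltW sh); have := ler_wpM2l b0 (ltW th).
  have -> : b = 1 - a by lra.
  lra.
have [g [gl gd]] := convex_subgradient w dconv.
have dD v s : d (v + lincomb u s) <= d v.
  apply/ler_addgt0Pr => h h0; have [t th] := dlt v (d v + h) ltac:(lra).
  have [r rE] := lincomb_combination u 1 1 s t.
  rewrite (le_trans (dle _ r))// -rE !scale1r opprD addrA addrK.
  exact: ltW.
have gD v : g v <= d (w + v) - d w.
  by have := gd (w + v); rewrite [w + v]addrC addrK; lra.
have [|f fg] := dual_of_linear (c := 1) gl.
  move=> v; rewrite mul1r (le_trans (gD v))//.
  apply/ler_addgt0Pr => h h0; have [s sh] := dlt w (d w + h) ltac:(lra).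
  have := dle (w + v) s; rewrite addrAC => /le_trans/(_ (ler_normD _ _)); lra.
have fw : f w = 0.
  apply: uw => n; have [s us] := lincomb_nth u n.
  (* [lincomb u r] is [- u n]; bounding [g] at both [u n] and [- u n] gives [g (u n) = 0]. *)
  have [r rE] := lincomb_combination u (-1) 0 s [::].
  have gu : g (u n) <= 0 by rewrite (le_trans (gD _))// subr_le0 us dD.
  have : g (- u n) <= 0.
    rewrite (le_trans (gD _))// subr_le0 -scaleN1r us.
    by have := dD w r; rewrite -rE scale0r addr0.
  rewrite -fg linearN oppr_le0 => gu'.
  by apply/le_anti/andP; split; [rewrite fg|exact: gu'].
apply: dlt; rewrite (le_lt_trans _ e0)//.
have gw : g (- w) = 0 by rewrite -fg linearN; apply/eqP; rewrite oppr_eq0; exact/eqP.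
have := gd 0; rewrite sub0r gw addr0 => /le_trans; apply.
by rewrite (le_trans (dle _ [::]))// subr0 normr0.
Qed.

Theorem bounded_weak_subsequence u (c : R) : reflexive_space E ->
  (forall n, `|u n| <= c) ->
  exists k x, increasing_seq k /\ weak_cvg (u \o k) x.
Proof.
move=> rE uc.
have [G [UG ooG]] := ultraFilterLemma (F := \oo) _.
have [x ux] := ultra_weak_limit rE UG uc.
have /choice[nf nfP] (q : seq rat) := norming_functional (lincomb u (map ratr q)).
(* The index chosen at stage [n] exceeds the earlier ones and approximates [nf q x] within
   [1 / (n + 1)] for the finitely many [q] of code below [n]. *)
pose P (s : seq nat) m := (forall i, i \in s -> (i < m)%N) /\
  forall q, (pickle q < size s)%N -> `|nf q x - nf q (u m)| < (size s).+1%:R^-1.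
have [s|k kP] := @dependent_sequence _ P.
  have PG := ultra_proper (F := G).
  suff : G (P s) by move=> /filter_ex.
  apply: filterI.
    apply: ooG; exists (\max_(i <- s) i).+1 => // m /= sm i si.
    by rewrite (leq_trans _ sm)// ltnS; exact: leq_bigmax_seq.
  move: (size s) => N.
  (* The codes are added one at a time with the tolerance fixed by [N]; a number that codes no list
     imposes nothing. *)
  suff : forall K, (K <= N)%N -> G [set m | forall q, (pickle q < K)%N ->
      `|nf q x - nf q (u m)| < N.+1%:R^-1] by apply.
  elim=> [_|K IHK KN]; first exact: filterE.
  have Kq : G [set m | if unpickle K is Some q then
      `|nf q x - nf q (u m)| < N.+1%:R^-1 else True].
    case: (unpickle K) => [q|]; last exact: filterE.
    by have /cvgrPdist_lt := ux (nf q); apply; rewrite invr_gt0 ltr0n.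
  apply: filterS2 (IHK (ltnW KN)) Kq => m mK mq q.
  rewrite ltnS leq_eqVlt => /orP[/eqP qK|]; last exact: mK.
  by move: mq; rewrite -qK pickleK.
have ik : increasing_seq k.
  apply/increasing_seqP => n; apply: (kP n.+1).1.
  by apply/mapP; exists n => //; rewrite mem_iota ltnSn.
have nfk q : (fun n => nf q (u (k n))) @ \oo --> nf q x.
  apply/cvgrPdist_lt => e e0; near=> n.
  have := (kP n).2 q; rewrite size_mkseq => /(_ _)/lt_trans; apply.
    by near: n; exact: nbhs_infty_gt.
  by near: n; exact: near_infty_natSinv_lt (PosNum e0).
exists k, x; split => // f; apply: ultra_cvg => G' UG' ooG'.
have PG' := ultra_proper (F := G').
have [x' ux'] := ultra_weak_limit rE UG' (fun n => uc (k n)).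
have nfx q : nf q (x' - x) = 0.
  rewrite dualB; apply/eqP; rewrite subr_eq0; apply/eqP.
  apply: norm_cvg_unique (ux' _) _ => A Ax; exact/ooG'/nfk.
suff -> : x = x' by exact: ux'.
apply/eqP; rewrite eq_sym -subr_eq0 -normr_eq0; apply: contraT => x'x.
have x0 : 0 < `|x' - x| by rewrite lt_def x'x normr_ge0.
(* Thus [x' - x] lies in the closed span of the [u n], although [x] and [x'] are limits along
   different ultrafilters. *)
have w0 (g : dual E) : (forall n, g (u n) = 0) -> g (x' - x) = 0.
  move=> gu; rewrite dualB.
  have g0 (F : set_system nat) (v : nat -> nat) y : ProperFilter F ->
      (fun n => g (u (v n))) @ F --> g y -> g y = 0.
    move=> PF gy; apply: norm_cvg_unique gy _.
    have -> : (fun n => g (u (v n))) = cst 0 by apply/funext => n; exact: gu.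
    exact: cvg_cst.
  by rewrite (g0 _ _ _ _ (ux' g)) (g0 _ id _ _ (ux g)) subrr.
(* Two errors of a quarter put a rational combination [y] at distance less than [|x' - x| / 2] from
   [x' - x], so [|y|] exceeds that half. Its norming functional vanishes at [x' - x], so
   [|y| <= |y - (x' - x)|], a contradiction. *)
have e4 : 0 < `|x' - x| / 4 by lra.
have [s xs] := annihilator_lincomb w0 e4.
have [q sq] := lincomb_rat_dense u s e4.
have [nle nq] := nfP q.
have := nle (lincomb u (map ratr q) - (x' - x)).
rewrite dualB nfx subr0 nq.
have := ler_distD (lincomb u s) (lincomb u (map ratr q)) (x' - x).
have := ler_distD (lincomb u (map ratr q)) (x' - x) 0.
rewrite !subr0 (distrC (lincomb u s)) (distrC _ (lincomb u s)).
rewrite (distrC (lincomb _ _) (x' - x)).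
lra.
Unshelve. all: by end_near.
Qed.

End weak_compactness.

(** If an ultrafilter on [S] contained no ball of radius [e], one could choose points of [S] at
    mutual distance at least [e], with no convergent subsequence. So it is Cauchy and converges; the
    hypothesis, applied to points of [S] tending to the limit, puts the limit in [S]. *)
Lemma sequentially_compact_compact (R : realType) (V : completeNormedModType R)
    (S : set V) :
  (forall u : nat -> V, (forall n, S (u n)) ->
     exists k x, [/\ increasing_seq k, S x & u \o k @ \oo --> x]) -> compact S.
Proof.
move=> seqS; rewrite compact_ultra => F UF FS; have PF := ultra_proper (F := F).
have cF : cvg F.
  apply: cauchy_cvg; apply: cauchy_exP => e e0; apply: contrapT => Fe.
  have [s|u uP] := @dependent_sequence V
      (fun s x => S x /\ forall y, y \in s -> e <= `|y - x|).
    suff : F [set x | S x /\ forall y, y \in s -> e <= `|y - x|].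
      by move=> /filter_ex.
    apply: filterI => //; elim: s => [|y s IHs]; first exact: filterE.
    have Fy : F (~` ball y e).
      by have [Fy|//] := in_ultra_setVsetC (ball y e) UF; exfalso; apply: Fe; exists y.
    apply: filterS2 IHs Fy => x sx; rewrite /= -ball_normE/= => /negP.
    by rewrite -leNgt => yx z; rewrite inE => /predU1P[->|/sx].
  have [k [x [/increasing_seqP ik Sx ukx]]] := seqS u (fun n => (uP n).1).
  have e2 : 0 < e / 2 by rewrite divr_gt0.
  have /cvgrPdist_lt/(_ _ e2)[N _ NP] := ukx.
  have := (uP (k N.+1)).2 (u (k N)); rewrite map_f ?mem_iota ?add0n ?(ik N : (k N < k N.+1)%N)// => /(_ erefl).
  apply/negP; rewrite -ltNge (le_lt_trans (ler_distD x _ _))//.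
  rewrite [e]splitr distrC ltrD//; first exact: (NP N (leqnn N)).
  exact: (NP N.+1 (leqnSn N)).
move/cvg_ex: cF => [x Fx].
have clS e : 0 < e -> exists y, S y /\ `|x - y| < e.
  move=> e0; have Fxe : F (ball x e) by apply: Fx; exact: nbhsx_ballx.
  by have [y [Sy]] := filter_ex (filterI FS Fxe); rewrite -ball_normE; exists y.
have /choice[u uP] n : exists y, S y /\ `|x - y| < n.+1%:R^-1.
  by apply: clS; rewrite invr_gt0 ltr0n.
have ux : u @ \oo --> x.
  apply/cvgrPdist_lt => e e0; near=> n; apply: lt_trans (uP n).2 _.
  by near: n; exact: near_infty_natSinv_lt (PosNum e0).
have [k [y [ik Sy uky]]] := seqS u (fun n => (uP n).1).
exists x; split => //.
suff -> : x = y by [].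
apply: norm_cvg_unique uky.
apply: cvg_comp ux; exact: increasing_seq_cvg.
Unshelve. all: by end_near.
Qed.

(** * The Clarke derivative *)

Section limf_esup_near.
Context (R : realType) (C : choiceType) (T : filteredType C) (F : set_system T).
Implicit Types (f : T -> \bar R) (r : R).

Lemma limf_esup_le f (l : \bar R) :
  F [set x | (f x <= l)%E] -> (limf_esup f F <= l)%E.
Proof.
move=> Fr; apply: le_trans (ereal_inf_lbound _) _; first by exists [set x | (f x <= l)%E].
by apply: ge_ereal_sup => _ [x ? <-].
Qed.

Lemma limf_esup_lt {PF : Filter F} f (l : \bar R) :
  (limf_esup f F < l)%E -> F [set x | (f x <= l)%E].
Proof.
move=> /ereal_inf_lt[_ [S FS <-]] Sr; apply: filterS FS => x Sx /=.
by rewrite (le_trans _ (ltW Sr))//; apply: ereal_sup_ubound; exists x.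
Qed.

Lemma limf_esup_ge {PF : ProperFilter F} f (l : \bar R) :
  F [set x | (l <= f x)%E] -> (l <= limf_esup f F)%E.
Proof.
move=> Fr; apply: le_ereal_inf_tmp => _ [S FS <-].
have [x [/= Sx rx]] := filter_ex (filterI FS Fr).
by rewrite (le_trans rx)//; apply: ereal_sup_ubound; exists x.
Qed.

End limf_esup_near.

Section clarke_derivative.
Context (R : realType) (E : normedModType R).
Implicit Types (h : E -> R) (x v : E) (r : R).

Lemma near_clarkeP x (P : set (E * R)) :
  filter_prod (nbhs x) (0 : R)^'+ P <->
  exists2 d, 0 < d & forall y l, `|y - x| < d -> 0 < l -> l < d -> P (y, l).
Proof.
split=> [[[/= A B] [/nbhs_ballP[a /= a0 aA] /nbhs_ballP[b /= b0 bB]] ABP]|[d d0 dP]].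
  exists (Num.min a b); first by rewrite lt_min a0.
  move=> y l; rewrite !lt_min => /andP[ya _] l0 /andP[_ lb].
  apply: ABP; split => /=.
    by apply: aA; rewrite -ball_normE /= distrC.
  by apply: bB => //; rewrite -ball_normE /= sub0r normrN gtr0_norm.
exists (ball x d, [set l | 0 < l /\ l < d]).
  split; first exact: nbhsx_ballx.
  by apply: filterI; [exact: nbhs_right_gt|exact: nbhs_right_lt].
move=> [y l] [/= + [l0 ld]]; rewrite -ball_normE/= distrC => yx; exact: dP.
Qed.

Lemma clarke_lt h x v r : (clarke h x v < r%:E)%E ->
  exists2 d, 0 < d & forall y l, `|y - x| < d -> 0 < l -> l < d ->
    (h (y + l *: v) - h y) / l <= r.
Proof. by move=> /limf_esup_lt/near_clarkeP[d d0 dP]; exists d. Qed.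

Lemma clarke_le h x v r d : 0 < d ->
  (forall y l, `|y - x| < d -> 0 < l -> l < d -> (h (y + l *: v) - h y) / l <= r) ->
  (clarke h x v <= r%:E)%E.
Proof. by move=> d0 dP; apply/limf_esup_le/near_clarkeP; exists d. Qed.

Lemma clarke_ge h x v r d : 0 < d ->
  (forall y l, `|y - x| < d -> 0 < l -> l < d -> r <= (h (y + l *: v) - h y) / l) ->
  (r%:E <= clarke h x v)%E.
Proof. by move=> d0 dP; apply/limf_esup_ge/near_clarkeP; exists d. Qed.

Lemma locally_lipschitz_ball h x : locally_lipschitz h ->
  exists L d : R, [/\ 0 <= L, 0 < d & forall y z, `|y - x| < d -> `|z - x| < d ->
    `|h y - h z| <= L * `|y - z|].
Proof.
move=> /(_ x)[W /nbhs_ballP[d /= d0 dW] [L [_ LW]]].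
(* The Lipschitz bound is available for constants strictly above [L]; the maximum keeps the constant
   nonnegative. *)
exists (Num.max 0 L + 1), d; split => //.
  by rewrite addr_ge0// le_max lexx.
move=> y z yd zd; apply: (LW (Num.max 0 L + 1) _ (y, z)).
  by rewrite ltr_pwDr// le_max lexx orbT.
by split; apply: dW; rewrite -ball_normE /= distrC.
Qed.

(* Shrinking [d] by [1 + |v|] keeps [y + l v] in the ball of radius [d]. *)
Lemma perturbation_ball x v y (l d : R) : `|y - x| < d / (1 + `|v|) -> 0 < l ->
  l < d / (1 + `|v|) -> [/\ `|y - x| < d, `|y + l *: v - x| < d & l < d].
Proof.
move=> yx l0 ld; have v0 : 0 < 1 + `|v| by rewrite ltr_pwDl.
have d0 : 0 < d by have := lt_trans l0 ld; rewrite pmulr_lgt0 ?invr_gt0.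
have dv : d / (1 + `|v|) <= d by rewrite ler_pdivrMr// ler_peMr ?lerDl// ltW.
split; [exact: lt_le_trans yx dv| |exact: lt_le_trans ld dv].
rewrite addrAC (le_lt_trans (ler_normD _ _))// normrZ gtr0_norm//.
have -> : d = d / (1 + `|v|) + d / (1 + `|v|) * `|v| by field; rewrite gt_eqF.
by rewrite ltr_leD// ler_wpM2r// ltW.
Qed.

Section lipschitz.
Variables (h : E -> R) (x : E).
Hypothesis hL : locally_lipschitz h.

(** The local Lipschitz constant bounds the difference quotients. This makes the Clarke derivative
    finite, so that [fine] loses nothing, and its linear minorants continuous. *)
Lemma clarke_bounds : exists L, forall v,
  ((- (L * `|v|))%:E <= clarke h x v)%E /\ (clarke h x v <= (L * `|v|)%:E)%E.
Proof.
have [L [d [L0 d0 Ld]]] := locally_lipschitz_ball x hL.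
exists L => v; have v0 : 0 < 1 + `|v| by rewrite ltr_pwDl.
have q y l : `|y - x| < d / (1 + `|v|) -> 0 < l -> l < d / (1 + `|v|) ->
    `|(h (y + l *: v) - h y) / l| <= L * `|v|.
  move=> yx l0 ld; have [yd yvd _] := perturbation_ball yx l0 ld.
  rewrite normrM normfV (gtr0_norm l0) ler_pdivrMr//.
  rewrite (le_trans (Ld _ _ yvd yd))// addrAC subrr add0r normrZ gtr0_norm//.
  by rewrite -mulrA [l * _]mulrC.
split; [apply: (@clarke_ge _ _ _ _ (d / (1 + `|v|)))|
        apply: (@clarke_le _ _ _ _ (d / (1 + `|v|)))]; rewrite ?divr_gt0// => y l yx l0 ld.
  by have := q y l yx l0 ld; rewrite ler_norml => /andP[].
by have := q y l yx l0 ld; rewrite ler_norml => /andP[].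
Qed.

Lemma clarkeE v : clarke h x v = (fine (clarke h x v))%:E.
Proof.
have [L /(_ v)[]] := clarke_bounds.
by case: (clarke h x v).
Qed.

Let p v := fine (clarke h x v).

Lemma clarke_fine_le v r : (clarke h x v <= r%:E)%E = (p v <= r).
Proof. by rewrite clarkeE lee_fin. Qed.

Let p_lt v e : 0 < e -> (clarke h x v < (p v + e)%:E)%E.
Proof. by move=> e0; rewrite clarkeE lte_fin ltrDl. Qed.

(** The increment is split at [y + l *: v], which is still an admissible base point near [x] for the
    direction [w]. *)
Lemma clarkeD v w : p (v + w) <= p v + p w.
Proof.
apply/ler_addgt0Pr => e e0; rewrite -clarke_fine_le.
have e2 : 0 < e / 2 by rewrite divr_gt0.
have [a a0 aP] := clarke_lt (p_lt v e2).
have [b b0 bP] := clarke_lt (p_lt w e2).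
have v0 : 0 < 1 + `|v| by rewrite ltr_pwDl.
have ab0 : 0 < Num.min a b by rewrite lt_min a0.
apply: (@clarke_le _ _ _ _ (Num.min a b / (1 + `|v|))); first by rewrite divr_gt0.
move=> y l yx l0 ld.
have [yd yvd ld'] := perturbation_ball yx l0 ld.
move: yd yvd ld'; rewrite !lt_min => /andP[ya _] /andP[_ yb] /andP[la lb].
have := aP _ _ ya l0 la; have := bP _ _ yb l0 lb.
rewrite scalerDr addrA.
have -> : h (y + l *: v + l *: w) - h y =
  (h (y + l *: v + l *: w) - h (y + l *: v)) + (h (y + l *: v) - h y) by ring.
rewrite [(_ + _) / l]mulrDl; lra.
Qed.

(** For [a > 0], a step [l] along [a *: v] is a step [l * a] along [v], whence the radius
    [d / a]. *)
Lemma clarkeZ_le a v : 0 <= a -> p (a *: v) <= a * p v.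
Proof.
rewrite le_eqVlt => /predU1P[<-|a0].
  rewrite scale0r mul0r -clarke_fine_le; have [L /(_ 0)[_]] := clarke_bounds.
  by rewrite normr0 mulr0.
apply/ler_addgt0Pr => e e0; rewrite -clarke_fine_le.
have [d d0 dP] := clarke_lt (p_lt v (divr_gt0 e0 a0)).
apply: (@clarke_le _ _ _ _ (Num.min d (d / a))); first by rewrite lt_min d0 divr_gt0.
move=> y l; rewrite !lt_min => /andP[yd _] l0 /andP[_ ld].
have := dP y (l * a) yd (mulr_gt0 l0 a0); rewrite -ltr_pdivlMr// => /(_ ld).
rewrite scalerA -(ler_pM2l a0) mulrDr [a * (e / a)]mulrC divfK ?gt_eqF//.
have aE (r : R) : a * (r / (l * a)) = r / l.
  by rewrite mulrC invfM -!mulrA mulVf ?gt_eqF// mulr1.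
by rewrite aE.
Qed.

Lemma clarke_convex : convex_real p.
Proof.
move=> y z s t s0 t0 _; rewrite (le_trans (clarkeD _ _))//.
by rewrite lerD// clarkeZ_le.
Qed.

End lipschitz.
End clarke_derivative.

(** * Riesz representation and the growth bound *)

Section hilbert.
Context (R : realType) (X : completeNormedModType R) (ip : {dot X for idfun}).
Hypothesis ipE : forall x : X, `|x| ^+ 2 = ip x x.

Lemma ipC x y : ip x y = ip y x.
Proof. by rewrite hermC expr0 mul1r. Qed.

Lemma sqr_normD x y : `|x + y| ^+ 2 = `|x| ^+ 2 + 2 * ip x y + `|y| ^+ 2.
Proof. by rewrite !ipE linearDl/= !linearDr/= (ipC y x); ring. Qed.

Lemma sqr_normZ (a : R) (x : X) : `|a *: x| ^+ 2 = a ^+ 2 * `|x| ^+ 2.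
Proof. by rewrite normrZ exprMn real_normK// num_real. Qed.

Lemma ipZr (a : R) x y : ip x (a *: y) = a * ip x y.
Proof. exact: linearZr_LR. Qed.

Lemma ip_le x y : ip x y <= `|x| * `|y|.
Proof.
have : `|x + y| ^+ 2 <= (`|x| + `|y|) ^+ 2.
  by rewrite ler_sqr ?nnegrE ?addr_ge0// ler_normD.
by rewrite sqr_normD; lra.
Qed.

(** The representative minimises [J]. The parallelogram identity [Jm] makes minimising sequences
    Cauchy, and the first-order condition at the minimiser is the claim. *)
Lemma riesz (g : dual X) : exists z, forall v, g v = ip z v.
Proof.
pose J x := `|x| ^+ 2 - 2 * g x.
have Jlb : has_inf (range J).
  split; first by exists (J 0), 0.
  exists (- opnorm g ^+ 2) => _ [x _ <-].
  have := ler_norm (g x); have := dual_le g x.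
  have := sqr_ge0 (`|x| - opnorm g); rewrite /J; lra.
pose m := inf (range J).
have mJ x : m <= J x by apply: ge_inf; [exact: Jlb.2|exists x].
have Jm x y : `|x - y| ^+ 2 <= 2 * (J x - m) + 2 * (J y - m).
  have := mJ (2^-1 *: (x + y)); have := sqr_normD x y; have := sqr_normD x (- y).
  have -> : ip x (- y) = - ip x y by rewrite -scaleN1r ipZr mulN1r.
  rewrite normrN /J sqr_normZ.
  have -> : g (2^-1 *: (x + y)) = 2^-1 * (g x + g y).
    by rewrite -[in LHS]/(g _) linearZ linearD.
  lra.
have /choice[u uP] n : exists x, J x < m + n.+1%:R^-1.
  have [|_ [x _ <-]] := inf_lt Jlb.1 (_ : m < m + n.+1%:R^-1); last by exists x.
  by rewrite ltrDl invr_gt0.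
have : cvg (u @ \oo).
  apply: cauchy_cvg; apply: cauchy_exP => e e0.
  have [N Ne] : exists N, N.+1%:R^-1 < e ^+ 2 / 4.
    have e4 : 0 < e ^+ 2 / 4 by rewrite divr_gt0// exprn_gt0.
    have [N _ NP] := near_infty_natSinv_lt (PosNum e4).
    by exists N; exact: (NP N (leqnn N)).
  have JN n : (N <= n)%N -> J (u n) < m + e ^+ 2 / 4.
    move=> Nn; rewrite (lt_trans (uP n))// ltrD2l (le_lt_trans _ Ne)//.
    by rewrite lef_pV2 ?posrE// ler_nat.
  exists (u N); exists N => // n /= Nn; rewrite -ball_normE/=.
  rewrite -ltr_sqr ?nnegrE// ?ltW//.
  by have := Jm (u N) (u n); have := JN n Nn; have := JN N (leqnn N); lra.
move=> /cvg_ex[z uz]; exists z => v.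
have Jz : J z <= m.
  apply/ler_addgt0Pr => e e0; apply: (cvgr_to_le (F := \oo) (f := J \o u)).
    apply: cvgB; last by apply: cvgZr; apply: cvg_comp uz (@dual_continuous _ _ g z).
    by rewrite expr2; apply: cvgM; apply: cvg_norm.
  near=> n; rewrite /= ltW// (lt_trans (uP n))// ltrD2l.
  by near: n; exact: near_infty_natSinv_lt (PosNum e0).
pose c := ip z v - g v.
suff : c ^+ 2 <= 0 by rewrite exprn_even_le0// subr_eq0 => /eqP.
have h t : 0 <= 2 * t * c + t ^+ 2 * `|v| ^+ 2.
  have := le_trans Jz (mJ (z + t *: v)); rewrite /J sqr_normD sqr_normZ ipZr.
  have -> : g (z + t *: v) = g z + t * g v by rewrite linearD linearZ.
  rewrite /c; lra.
have n0 : 0 < 1 + `|v| ^+ 2 by rewrite ltr_pwDl// sqr_ge0.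
(* At this [t] the quadratic is negative unless [c = 0]; the summand [1] covers [v = 0]. *)
have := h (- c / (1 + `|v| ^+ 2)).
have -> : 2 * (- c / (1 + `|v| ^+ 2)) * c + (- c / (1 + `|v| ^+ 2)) ^+ 2 * `|v| ^+ 2 =
   - (c ^+ 2 * (2 + `|v| ^+ 2)) / (1 + `|v| ^+ 2) ^+ 2.
  by field; rewrite gt_eqF.
rewrite mulNr oppr_ge0 pmulr_lle0 ?invr_gt0 ?exprn_gt0// pmulr_lle0//.
Unshelve. all: by end_near.
Qed.

(** A subgradient of the sublinear function [p] at [z] lies below [p] everywhere and equals it at
    [z]. Its Riesz representative is a Clarke subgradient, so its norm is at most [K], and
    Cauchy-Schwarz concludes. *)
Lemma clarke_growth (h : X -> R) (x z : X) (K : R) : locally_lipschitz h ->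
  (set_norm (clarke_subgrad ip h x) <= K%:E)%E ->
  (clarke h x z <= (K * `|z|)%:E)%E.
Proof.
move=> hL hK; rewrite clarke_fine_le//; pose p v := fine (clarke h x v).
have [g [gl gp]] := convex_subgradient z (clarke_convex x hL).
have glep v : g v <= p v.
  by have := gp (z + v); have := clarkeD x hL z v; rewrite [z + v]addrC addrK /p; lra.
have [L Lp] := clarke_bounds x hL.
have [|f fg] := dual_of_linear (c := L) gl.
  by move=> v; rewrite (le_trans (glep v))// -clarke_fine_le//; exact: (Lp v).2.
have [y yf] := riesz f.
have yK : `|y| <= K.
  rewrite -lee_fin (le_trans _ hK)//; apply: ereal_sup_ubound.
  by exists y => // v; rewrite clarkeE// lee_fin -yf fg; exact: glep.
have pz : p z <= g z.
  have := gp 0; have := clarkeZ_le x hL z (lexx 0).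
  rewrite scale0r mul0r sub0r /p -!fg.
  have -> : f (- z) = - f z by rewrite linearN.
  lra.
rewrite (le_trans pz)// -fg yf (le_trans (ip_le _ _))//.
by rewrite ler_wpM2r.
Qed.

End hilbert.

(** * Compact operators, Lipschitz and semicontinuous functions *)

Lemma bounded_image_norm (R : realType) (E F : normedModType R) (g : E -> F) :
  (forall B : set E, bounded_set B -> bounded_set (g @` B)) ->
  forall c : R, exists b : R, forall x, `|x| <= c -> `|g x| <= b.
Proof.
move=> gB c; have /gB : bounded_set [set x : E | `|x| <= c].
  by exists c; split=> [|r cr x /= xc]; rewrite ?num_real// (le_trans xc)// ltW.
move=> [b [_ gb]]; exists (b + 1) => x xc.
by apply: (gb (b + 1)); rewrite ?ltrDl//; exists x.
Qed.

Lemma convex_functionT (R : realType) (E : normedModType R) (p : E -> R) :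
  convex_function setT p -> convex_real p.
Proof.
move=> cp x y s t s0 t0 st; have s1 : s <= 1 by lra.
have := cp (Itv01 s0 s1) x y; rewrite !inE => /(_ I I).
have -> : t = 1 - s by lra.
by [].
Qed.

Section bounded_linear.
Context (R : realType) (V X : normedModType R) (M : {linear V -> X}).
Hypothesis M_bounded : bounded_near M (nbhs (0 : V)).

Lemma opnorm_ub (x : V) : `|x| <= 1 -> `|M x| <= opnorm M.
Proof.
move=> x1; apply: ub_le_sup; last by exists x.
have /linear_boundedP/pinfty_ex_gt0[r r0 Mr] := M_bounded.
by exists r => _ [y /= y1 <-]; rewrite (le_trans (Mr y))// ler_piMr// ltW.
Qed.

Lemma opnorm_le (x : V) : `|M x| <= opnorm M * `|x|.
Proof.
have [->|x0] := eqVneq x 0; first by rewrite linear0 !normr0 mulr0.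
have nx0 : 0 < `|x| by rewrite normr_gt0.
rewrite -ler_pdivrMr// mulrC -[X in X * _]ger0_norm ?invr_ge0// -normrZ -linearZ.
by apply: opnorm_ub; rewrite normrZ normfV normr_id mulVf// gt_eqF.
Qed.

Lemma opnorm_ge0 : 0 <= opnorm M.
Proof. by rewrite (le_trans (normr_ge0 (M 0)))// opnorm_ub// normr0. Qed.

Lemma linear_cvg (T : Type) (F : set_system T) {FF : Filter F} (u : T -> V) x :
  u @ F --> x -> (fun t => M (u t)) @ F --> M x.
Proof.
move=> ux; apply: cvg_comp ux _.
exact: (linear_bounded_continuous M).1.
Qed.

(** Along any ultrafilter [M (u n)] has a norm limit [y]. A norming functional of [M x - y] composed
    with [M] is in the dual of [V], so weak convergence forces [y = M x]. *)
Lemma compact_operator_weak_cvg (u : nat -> V) (x : V) (c : R) :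
  compact_operator M -> (forall n, `|u n| <= c) -> weak_cvg u x ->
  (fun n => M (u n)) @ \oo --> M x.
Proof.
move=> cM uc ux.
have /cM : bounded_set [set v : V | `|v| <= c].
  by exists c; split=> [|r cr y /= yc]; rewrite ?num_real// (le_trans yc)// ltW.
rewrite precompactE => cK; apply: ultra_cvg => G UG ooG.
have PG := ultra_proper (F := G).
have [n|y My] := ultra_compact_cvg (u := fun n => M (u n)) UG cK.
  by apply: subset_closure; exists (u n) => //=; exact: uc.
suff -> : M x = y by [].
have [g [gle gy]] := norming_functional (M x - y).
pose gM v : R^o := g (M v).
have gMl : linear gM by move=> a v w; rewrite /gM !linearP.
have [v|f fg] := @dual_of_linear _ _ _ (opnorm M) gMl.
  by rewrite (le_trans (gle _))// opnorm_le.
apply/eqP; rewrite -subr_eq0 -normr_eq0 -gy dualB subr_eq0; apply/eqP.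
have gMx : (fun n => g (M (u n))) @ G --> g (M x).
  rewrite -[g (M x)](fg x).
  have -> : (fun n => g (M (u n))) = (fun n => f (u n)).
    by apply/funext => n; rewrite fg.
  by move=> A Ax; apply: ooG; exact: (ux f).
apply: norm_cvg_unique gMx _.
by apply: cvg_comp My _; exact: dual_continuous.
Qed.

End bounded_linear.

Lemma lipschitz_cvg (R : realType) (E : normedModType R) (p : E -> R) (c : R) :
  (forall x y, p x - p y <= c * `|x - y|) ->
  forall (T : Type) (F : set_system T) (FF : Filter F) (u : T -> E) x,
    u @ F --> x -> (fun t => p (u t)) @ F --> p x.
Proof.
move=> pc T F FF u x ux; apply/cvgrPdist_le => e e0.
(* [c] carries no sign here; [|c| + 1] is a positive constant to divide by. *)
have c0 : 0 < `|c| + 1 by rewrite ltr_wpDl.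
have /cvgrPdist_le/(_ _ (divr_gt0 e0 c0)) := ux.
apply: filterS => t xt.
have le1 y z : p y - p z <= (`|c| + 1) * `|y - z|.
  rewrite (le_trans (pc _ _))// ler_wpM2r// (le_trans (ler_norm c))//; lra.
move: xt; rewrite ler_pdivlMr// mulrC => xt.
rewrite ler_norml (le_trans (le1 _ _) xt) andbT lerNl opprB.
by rewrite (le_trans (le1 _ _))// distrC.
Qed.

(* The subgradient at [x] is weakly continuous and makes [p] weakly lower
   semicontinuous. *)
Lemma lipschitz_convex_subgradient (R : realType) (E : normedModType R)
    (p : E -> R) (c : R) (x : E) :
  convex_real p -> (forall x y, p x - p y <= c * `|x - y|) ->
  exists g : dual E, forall v, p x + g (v - x) <= p v.
Proof.
move=> cp pc; have [g [gl gp]] := convex_subgradient x cp.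
have [v|f fg] := dual_of_linear (c := c) gl.
  have := gp (x + v); have := pc (x + v) x; rewrite [x + v]addrC addrK; lra.
by exists f => v; rewrite fg.
Qed.

Lemma upper_semicontinuous_cvg (R : realType) (S : topologicalType)
    (F : S -> \bar R) (I : Type) (G : set_system I) {FG : Filter G}
    (u : I -> S) (x : S) (r : R) :
  upper_semicontinuous F -> u @ G --> x -> (F x < r%:E)%E ->
  \forall i \near G, (F (u i) <= r%:E)%E.
Proof.
move=> uF ux Fr; have [|W xW WF] := uF x (- r); first by rewrite EFinN lteN2.
have uW : G (u @^-1` W) := ux _ xW.
by apply: filterS uW => i /WF; rewrite EFinN lteN2; exact: ltW.
Qed.

(** * The solution set *)

Section solutions.
Context (R : realType) (V : completeNormedModType R) (X : completeNormedModType R)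
  (ip : {dot X for idfun}).
Context (A : V -> dual V) (j : X -> X -> R) (M : {linear V -> X})
  (U : V -> set V) (phi : V -> R) (f : dual V) (m_A d1 d2 d3 c_phi : R).
Hypothesis X_hilbert : forall x : X, `|x| ^+ 2 = ip x x.
Hypothesis A_pseudomonotone : pseudomonotone A.
Hypothesis m_A_gt0 : 0 < m_A.
Hypothesis A_strongly_monotone : forall v1 v2 : V,
  m_A * `|v1 - v2| ^+ 2 <= (A v1 - A v2) (v1 - v2).
Hypothesis j_locally_lipschitz : forall w : X, locally_lipschitz (j w).
Hypotheses (d1_ge0 : 0 <= d1) (d2_ge0 : 0 <= d2) (d3_ge0 : 0 <= d3).
Hypothesis j_growth : forall w v : X,
  (set_norm (clarke_subgrad ip (j w) v)
     <= (d1 + d2 * `|w| + d3 * `|v|)%:E)%E.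
Hypothesis j_usc : upper_semicontinuous
  (fun p : X * X * X => clarke (j p.1.1) p.1.2 p.2).
Hypothesis M_bounded : bounded_near M (nbhs (0 : V)).
Hypothesis M_compact : compact_operator M.
Hypothesis U_0 : forall v : V, U v 0.
Hypothesis U_mosco : weakly_mosco_continuous U.
Hypothesis phi_convex : convex_real phi.
Hypothesis phi_lipschitz : forall v1 v2 : V,
  phi v1 - phi v2 <= c_phi * `|v1 - v2|.
Hypothesis smallness : (d2 + d3) * opnorm M ^+ 2 < m_A.

Let S := solution_set A f j M phi U.
Let J (v z : V) : R := fine (clarke (j (M v)) (M v) (M z - M v)).

Let JE v z : clarke (j (M v)) (M v) (M z - M v) = (J v z)%:E.
Proof. exact: clarkeE. Qed.

(** Both arguments of [j] are [M v], so the two growth coefficients add up. *)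
Let J_le v z : J v z <= (d1 + (d2 + d3) * `|M v|) * `|M z - M v|.
Proof.
rewrite -lee_fin -JE [(d2 + d3) * _]mulrDl addrA; exact: (clarke_growth X_hilbert).
Qed.

(** The real-valued form, with the pairing turned to [v - z] as in pseudomonotonicity. *)
Let solutionP v : S v <-> U v v /\ forall z, U v z ->
  A v (v - z) <= f (v - z) + J v z + phi z - phi v.
Proof.
have Afz z : (A v - f) (z - v) = f (v - z) - A v (v - z).
  have -> : (A v - f) (z - v) = A v (z - v) - f (z - v) by [].
  by rewrite !dualB; ring.
split=> -[Uvv Sv]; split => // z /Sv; rewrite JE Afz -!EFinD lee_fin; lra.
Qed.

Lemma solutions_bounded : exists C, forall v, S v -> `|v| <= C.
Proof.
pose a := opnorm M; pose k := opnorm f + opnorm (A 0) + c_phi + d1 * a.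
(* Testing with [0] gives [(m_A - (d2 + d3) a^2) |v|^2 <= k |v|], where [k] gathers the terms linear
   in [|v|]; the maximum covers [v = 0]. *)
exists (Num.max 0 (k / (m_A - (d2 + d3) * a ^+ 2))) => v.
move=> /solutionP[_ /(_ 0 (U_0 v))].
have a0 : 0 <= a := opnorm_ge0 M_bounded.
have dd0 : 0 <= d2 + d3 by rewrite addr_ge0.
have small : 0 < m_A - (d2 + d3) * a ^+ 2 by rewrite subr_gt0.
rewrite subr0 => Av.
have [->|v0] := eqVneq v 0; first by rewrite normr0 le_max lexx.
rewrite le_max; apply/orP; right.
rewrite ler_pdivlMr// -(@ler_pM2l _ `|v|) ?normr_gt0//.
have mon : m_A * `|v| ^+ 2 <= A v v - A 0 v.
  by have := A_strongly_monotone v 0; rewrite subr0.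
have Jv : J v 0 <= d1 * (a * `|v|) + (d2 + d3) * (a * `|v|) ^+ 2.
  have := J_le v 0; rewrite linear0 sub0r normrN => /le_trans; apply.
  have Mv : `|M v| <= a * `|v| := opnorm_le M_bounded v.
  by rewrite mulrDl -mulrA lerD// ler_wpM2l// -expr2 ler_sqr ?nnegrE// mulr_ge0.
have fv : f v <= opnorm f * `|v| := le_trans (ler_norm _) (dual_le f v).
have A0v : - A 0 v <= opnorm (A 0) * `|v|.
  by rewrite (le_trans (ler_norm _))// normrN dual_le.
have phiv := phi_lipschitz 0 v; rewrite sub0r normrN in phiv.
rewrite /k; move: mon Av Jv; rewrite exprMn; lra.
Qed.

Section limit.
Context (w : nat -> V) (u0 : V).
Hypothesis wS : forall n, S (w n).
Hypothesis wu0 : weak_cvg w u0.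

Let weak_diff (g : dual V) : (fun n => g (w n - u0)) @ \oo --> (0 : R).
Proof.
have -> : (fun n => g (w n - u0)) = (fun n => g (w n) - g u0).
  by apply/funext => n; rewrite dualB.
by rewrite -(subrr (g u0)); apply: cvgB; [exact: wu0|exact: cvg_cst].
Qed.

Lemma weak_limit_fixed : U u0 u0.
Proof.
apply: ((U_mosco wu0).1 w id u0) => // n.
exact: ((solutionP (w n)).1 (wS n)).1.
Qed.

Let M_cvg : (fun n => M (w n)) @ \oo --> M u0.
Proof.
have [C SC] := solutions_bounded.
by apply: (@compact_operator_weak_cvg _ _ _ M M_bounded w u0 C) => // n; exact: SC.
Qed.

Let A_bounded : exists2 b, 0 <= b & forall n v, `|A (w n) v| <= b * `|v|.
Proof.
have [C SC] := solutions_bounded.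
have [b bP] := bounded_image_norm A_pseudomonotone.1 C.
have Ab n : opnorm (A (w n)) <= b by exact/bP/SC.
exists b => [|n v]; first exact: le_trans (normr_ge0 (A (w 0%N))) (Ab 0%N).
by rewrite (le_trans (dual_le _ _))// ler_wpM2r.
Qed.

(** [M (y n)] and [M (w n)] share the limit [M u0], so the last factor in [J_le] tends to [0]. *)
Let J_vanish (y : nat -> V) : y @ \oo --> u0 -> exists2 r : nat -> R,
  r @ \oo --> (0 : R) & forall n, J (w n) (y n) <= r n.
Proof.
move=> yu0.
exists (fun n => (d1 + (d2 + d3) * `|M (w n)|) * `|M (y n) - M (w n)|).
  have -> : 0 = (d1 + (d2 + d3) * `|M u0|) * `|M u0 - M u0|.
    by rewrite subrr normr0 mulr0.
  apply: cvgM.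
    apply: cvgD; first exact: cvg_cst.
    by apply: cvgMr; exact: cvg_norm.
  by apply: cvg_norm; apply: cvgB => //; exact: linear_cvg.
by move=> n; exact: J_le.
Qed.

Lemma A_gap_vanish : exists2 r : nat -> R, r @ \oo --> (0 : R) &
  forall n, A (w n) (w n - u0) <= r n.
Proof.
have [y Uy yu0] := (U_mosco wu0).2 _ weak_limit_fixed.
have [b b0 Ab] := A_bounded.
have [r r0 Jr] := J_vanish yu0.
have [g gphi] := lipschitz_convex_subgradient u0 phi_convex phi_lipschitz.
have y0 : (fun n => `|y n - u0|) @ \oo --> (0 : R).
  rewrite -(normr0 V) -(subrr u0); apply: cvg_norm.
  by apply: cvgB => //; exact: cvg_cst.
(* Replacing [y n] by [u0] in [f], in [phi] and in the pairing with [A (w n)] costs the three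
   coefficients of [|y n - u0|]; [g] bounds [phi u0 - phi (w n)]. *)
exists (fun n => f (w n - u0) - g (w n - u0) + r n +
    (opnorm f + c_phi + b) * `|y n - u0|).
  rewrite -[X in _ --> X](_ : 0 - 0 + 0 + (opnorm f + c_phi + b) * 0 = 0); last first.
    by rewrite mulr0 subrr !addr0.
  by apply: cvgD; [apply: cvgD => //; exact: cvgB|exact: cvgMr].
move=> n; have := ((solutionP (w n)).1 (wS n)).2 _ (Uy n).
have := Jr n; have := gphi (w n); have := phi_lipschitz (y n) u0.
have := le_trans (ler_norm _) (Ab n (y n - u0)).
have := le_trans (ler_norm _) (dual_le f (u0 - y n)).
rewrite (distrC u0) !dualB; lra.
Qed.

Lemma weak_limit_strong : w @ \oo --> u0.
Proof.
have [r r0 Ar] := A_gap_vanish.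
have s0 : (fun n => r n - A u0 (w n - u0)) @ \oo --> (0 : R).
  by rewrite -(subrr 0); exact: cvgB.
apply/cvgrPdist_lt => e e0.
have me : 0 < m_A * e ^+ 2 by rewrite mulr_gt0// exprn_gt0.
apply: filterS (cvgr_lt _ s0 _ me) => n rn.
suff : m_A * `|w n - u0| ^+ 2 < m_A * e ^+ 2.
  by rewrite ltr_pM2l// ltr_sqr ?nnegrE// ?ltW// distrC.
rewrite (le_lt_trans _ rn)// (le_trans (A_strongly_monotone _ _))//.
have -> : (A (w n) - A u0) (w n - u0) = A (w n) (w n - u0) - A u0 (w n - u0) by [].
by rewrite lerB.
Qed.

Lemma weak_limit_solution : S u0.
Proof.
have wu := weak_limit_strong.
apply/solutionP; split=> [|z Uz]; first exact: weak_limit_fixed.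
have [y Uy yz] := (U_mosco wu0).2 _ Uz.
have [b b0 Ab] := A_bounded.
have [r r0 Ar] := A_gap_vanish.
rewrite -lee_fin.
apply: le_trans (A_pseudomonotone.2 w u0 wu0 _ z) _.
  apply/lee_addgt0Pr => e e0; rewrite add0e; apply: limf_esup_le.
  apply: filterS (cvgr_le _ r0 _ e0) => n rn /=.
  by rewrite lee_fin (le_trans (Ar n)).
(* Passing to the limsup, it is enough to bound the terms eventually by the right-hand side plus
   [e], half of it for the Clarke term and half for the rest. *)
apply: le_trans (limn_einf_sup _) _.
apply/lee_addgt0Pr => e e0; rewrite -EFinD; apply: limf_esup_le.
have e2 : 0 < e / 2 by rewrite divr_gt0.
have Jz : \forall n \near \oo, J (w n) (y n) <= J u0 z + e / 2.
  have trip : (fun n => (M (w n), M (w n), M (y n) - M (w n))) @ \oo -->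
      (M u0, M u0, M z - M u0).
    have Mzw : (fun n => M (y n) - M (w n)) @ \oo --> M z - M u0.
      by apply: cvgB => //; exact: linear_cvg.
    exact: cvg_pair (cvg_pair M_cvg M_cvg) Mzw.
  have Jlt : (clarke (j (M u0)) (M u0) (M z - M u0)%R < (J u0 z + e / 2)%:E)%E.
    by rewrite JE lte_fin ltrDl.
  apply: filterS (upper_semicontinuous_cvg j_usc trip Jlt) => n.
  by rewrite /= JE lee_fin.
(* The test points are [y n] rather than [z]; the term with [b] pays for this change in the pairing
   with [A (w n)]. *)
have rest : (fun n => f (w n - y n) + phi (y n) - phi (w n) + b * `|y n - z|)
    @ \oo --> f (u0 - z) + phi z - phi u0 + b * `|z - z|.
  apply: cvgD; last first.
    by apply: cvgMr; apply: cvg_norm; apply: cvgB => //; exact: cvg_cst.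
  apply: cvgB; last exact: (lipschitz_cvg phi_lipschitz).
  apply: cvgD; last exact: (lipschitz_cvg phi_lipschitz).
  by apply: cvg_comp (cvgB wu yz) _; exact: dual_continuous.
rewrite subrr normr0 mulr0 addr0 in rest.
have lt_e2 : f (u0 - z) + phi z - phi u0 < f (u0 - z) + phi z - phi u0 + e / 2.
  by rewrite ltrDl.
apply: filterS2 Jz (cvgr_le _ rest _ lt_e2) => n Jn rn /=.
rewrite lee_fin.
have := ((solutionP (w n)).1 (wS n)).2 _ (Uy n).
have := le_trans (ler_norm _) (Ab n (y n - z)).
move: rn Jn; rewrite !dualB; lra.
Qed.

End limit.

Lemma solution_set_compact : reflexive_space V -> compact S.
Proof.
move=> rV; have [C SC] := solutions_bounded.
apply: sequentially_compact_compact => u uS.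
have [k [x [ik ukx]]] := bounded_weak_subsequence rV (fun n => SC _ (uS n)).
have ukS n : S ((u \o k) n) := uS (k n).
exists k, x; split => //; first exact: weak_limit_solution ukS ukx.
exact: weak_limit_strong ukS ukx.
Qed.

End solutions.

Theorem corollary8 (R : realType)
    (V : completeNormedModType R) (V_reflexive : reflexive_space V)
    (X : completeNormedModType R) (ip : {dot X for idfun})
    (X_hilbert : forall x : X, `|x| ^+ 2 = ip x x)
    (A : V -> dual V) (j : X -> X -> R) (M : {linear V -> X})
    (U : V -> set V) (phi : V -> R) (f : dual V)
    (m_A d1 d2 d3 c_phi : R)
    (A_pseudomonotone : pseudomonotone A)
    (m_A_gt0 : 0 < m_A)
    (A_strongly_monotone : forall v1 v2 : V,
       m_A * `|v1 - v2| ^+ 2 <= (A v1 - A v2) (v1 - v2))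
    (j_locally_lipschitz : forall w : X, locally_lipschitz (j w))
    (d1_ge0 : 0 <= d1) (d2_ge0 : 0 <= d2) (d3_ge0 : 0 <= d3)
    (j_growth : forall w v : X,
       (set_norm (clarke_subgrad ip (j w) v)
          <= (d1 + d2 * `|w| + d3 * `|v|)%:E)%E)
    (j_usc : upper_semicontinuous
       (fun p : X * X * X => clarke (j p.1.1) p.1.2 p.2))
    (M_bounded : bounded_near M (nbhs (0 : V)))
    (M_compact : compact_operator M)
    (U_nonempty : forall v : V, U v !=set0)
    (U_closed : forall v : V, closed (U v))
    (U_convex : forall v : V, convex_set (U v))
    (U_0 : forall v : V, U v 0)
    (U_mosco : weakly_mosco_continuous U)
    (phi_convex : convex_function setT phi)
    (phi_lsc : lower_semicontinuous (EFin \o phi))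
    (c_phi_gt0 : 0 < c_phi)
    (phi_lipschitz : forall v1 v2 : V,
       phi v1 - phi v2 <= c_phi * `|v1 - v2|)
    (smallness : (d2 + d3) * opnorm M ^+ 2 < m_A) :
  compact (solution_set A f j M phi U).
Proof.
exact: (solution_set_compact X_hilbert A_pseudomonotone m_A_gt0
  A_strongly_monotone j_locally_lipschitz d1_ge0 d2_ge0 d3_ge0 j_growth j_usc
  M_bounded M_compact U_0 U_mosco (convex_functionT phi_convex) phi_lipschitz
  smallness V_reflexive).
Qed.
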